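(* Assume $k$ has characteristic $0$. Let $I$ be an $\mathfrak m$-primary monomial ideal of the polynomial ring $S$ in $n$ variables over $k$, with asymptotic generating degree $d$, and let $l$ be the number of variables whose $d$-th power is a minimal generator of $I$. Write $\operatorname{reg} I^m = dm + e_m$ for all $m$. Then $e_{m+1} \geq e_m$ if $$m > (n-1)(d-2) + (\mu_m - 1)(l-1)(d-1),$$ where $\mu_m$ is the minimum of $\bar m(m,a)$ over monomials $a \in w(I^m)$.
   Context: $S$ is a polynomial ring over a field $k$ in $n$ variables with its standard grading, $\mathfrak m$ is its homogeneous maximal ideal, and $\operatorname{reg}$ denotes Castelnuovo-Mumford regularity. $m$ ranges over positive integers. $I_{\leq t}$ is the ideal generated by the forms in $I$ of degree at most $t$; the asymptotic generating degree of $I$ is the minimal $d$ such that $I$ is integral over $I_{\leq d}$. For a homogeneous ideal $K$ of $S$, $\sigma(K) = \{\alpha \in S/K : \alpha \neq 0,\ \mathfrak m \alpha = 0\}$, $\omega(K) \subset \sigma(K)$ is the set of elements of $\sigma(K)$ of maximal (total) degree, and $w(K)$ is the set of homogeneous elements of $S$ whose image in $S/K$ lies in $\omega(K)$. An $\mathfrak m$-primary monomial ideal $I$ contains a pure power of each variable among its minimal generators, the largest exponent being $d$. Name the variables $x, y_1,\ldots,y_{l-1}, z_1,\ldots,z_k$ with $l + k = n$ so that $$I = (x^d, y_1^d, \ldots, y_{l-1}^d, z_1^{d_1}, \ldots, z_k^{d_k}, h_1,\ldots,h_r),\qquad d > d_1 \geq \cdots \geq d_k,$$ where $h_1,\ldots,h_r$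 are the minimal generators that are not pure powers. Let $Y = (y_1^d,\ldots,y_{l-1}^d)$ and $Z = (z_1^{d_1},\ldots,z_k^{d_k})$. For an ideal $K$ and a form $f$, $\operatorname{ord}_K(f)$ is the unique natural number $t$ with $f \in K^t \setminus K^{t+1}$. A monomial $a$ of $S$ is written uniquely as $$a = x^{m_x d + o_x}\, y_1^{m_{y_1}d + o_{y_1}} \cdots y_{l-1}^{m_{y_{l-1}}d + o_{y_{l-1}}}\, z_1^{m_{z_1}d_1 + o_{z_1}} \cdots z_k^{m_{z_k}d_k + o_{z_k}}$$ with the $m$'s as large as possible (so $0 \le o_x, o_{y_i} < d$ and $0\le o_{z_i} < d_i$); thus $\operatorname{ord}_Y(a) = \sum_i m_{y_i}$ and $\operatorname{ord}_Z(a) = \sum_i m_{z_i}$. For a natural number $m$, $\bar m(m,a) = m - m_x - \operatorname{ord}_Y(a) - \operatorname{ord}_Z(a)$. *)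

(* Defs.v *)
(* Ideals are Prop-valued predicates on S = {mpoly k[n]}, and elements of a
   quotient S/K are handled through their representatives in S. *)
From HB Require Import structures.
From mathcomp Require Import all_boot all_order all_algebra.
From mathcomp Require Export mpoly.

Set Implicit Arguments.
Unset Strict Implicit.
Unset Printing Implicit Defensive.

Import Order.TTheory GRing.Theory Num.Theory.
Local Open Scope ring_scope.

Section Ideals.
Variables (k : fieldType) (n : nat).
Local Notation S := {mpoly k[n]}.
Implicit Types (K J G : S -> Prop) (f g : S) (u v : 'X_{1..n}).

Definition is_ideal K : Prop :=
  [/\ K 0, forall f g, K f -> K g -> K (f + g) & forall f g, K g -> K (f * g)].

Definition ideal_gen G : S -> Prop := fun f =>
  exists s : seq (S * S),
    (forall c, c \in s -> G c.2) /\ f = \sum_(c <- s) c.1 * c.2.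

(* K^0 is the unit ideal, generated by the empty product. *)
Definition ideal_pow K (t : nat) : S -> Prop :=
  ideal_gen (fun f => exists g : 'I_t -> S,
    (forall i, K (g i)) /\ f = \prod_(i < t) g i).

Definition max_ideal : S -> Prop :=
  ideal_gen (fun f => exists i : 'I_n, f = 'X_i).

Definition radical K : S -> Prop := fun f => exists t : nat, K (f ^+ t).

Definition is_primary K : Prop :=
  [/\ is_ideal K, ~ K 1
    & forall f g, K (f * g) -> ~ K f -> radical K g].

Definition is_m_primary K : Prop :=
  is_primary K /\ (forall f, radical K f <-> max_ideal f).

Definition is_monomial_ideal K : Prop :=
  exists M : 'X_{1..n} -> Prop,
    forall f, K f <-> ideal_gen (fun g => exists2 u, M u & g = 'X_[u]) f.

Definition min_mono_gen K u : Prop :=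
  K 'X_[u] /\ (forall v, K 'X_[v] -> (v <= u)%MM -> v = u).

Definition is_ord K f (t : nat) : Prop :=
  ideal_pow K t f /\ ~ ideal_pow K t.+1 f.

(* f^N + a_1 f^(N-1) + ... + a_N = 0 with a_j in J^j; here a_j is [a (j - 1)]. *)
Definition integral_over_ideal J f : Prop :=
  exists N : nat, exists a : nat -> S,
    [/\ (0 < N)%N, (forall i, (i < N)%N -> ideal_pow J i.+1 (a i))
      & f ^+ N + \sum_(i < N) a i * f ^+ (N - i.+1) = 0].

Definition ideal_le K (t : nat) : S -> Prop :=
  ideal_gen (fun f => K f /\ exists2 s : nat, (s <= t)%N & f \is s.-homog).

Definition asymptotic_generating_degree K (d : nat) : Prop :=
  let integral_over_le t :=
    forall f, K f -> integral_over_ideal (ideal_le K t) f in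
  integral_over_le d /\ (forall t, integral_over_le t -> (d <= t)%N).

(* Minimal graded free resolution ... -> F_1 -> F_0 -> K -> 0 of a homogeneous
   ideal K: F_i is the sum of the S(- res_shift i j), its elements are row
   vectors, and the maps act by right multiplication.  Shifts can be taken in
   nat since K lives in nonnegative degrees and, by minimality, no basis
   element of F_i is sent to 0. *)
Record min_graded_res K := MinGradedRes {
  res_rank : nat -> nat;
  res_shift : forall i, 'I_(res_rank i) -> nat;
  res_aug : 'cV[S]_(res_rank 0);
  res_diff : forall i, 'M[S]_(res_rank i.+1, res_rank i);
  res_aug_homog : forall j, res_aug j 0 \is (res_shift j).-homog;
  res_diff_homog : forall i j j', res_diff i j j' = 0 \/
    exists2 s : nat, res_diff i j j' \is s.-homog
                   & (s + res_shift j')%N = res_shift j;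
  res_aug_image : forall f,
    K f <-> exists v : 'rV[S]_(res_rank 0), f = (v *m res_aug) 0 0;
  res_exact0 : forall v : 'rV[S]_(res_rank 0),
    v *m res_aug = 0 <-> exists w, v = w *m res_diff 0;
  res_exactS : forall i (v : 'rV[S]_(res_rank i.+1)),
    v *m res_diff i = 0 <-> exists w, v = w *m res_diff i.+1;
  res_minimal : forall i j j', max_ideal (res_diff i j j')
}.

(* reg K = r. Minimal graded free resolutions are unique up to isomorphism, so
   this determines r. *)
Definition is_regularity K (r : int) : Prop :=
  exists F : min_graded_res K,
    (exists i, exists j : 'I_(res_rank F i), r = (res_shift j)%:Z - i%:Z) /\
    (forall i (j : 'I_(res_rank F i)), (res_shift j)%:Z - i%:Z <= r).

(* The class of f in S/K lies in sigma(K). *)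
Definition in_sigma K f : Prop :=
  ~ K f /\ (forall g, max_ideal g -> K (g * f)).

(* The class of f in S/K, for K homogeneous, has total degree t: t is the
   largest degree of a homogeneous component of f that is nonzero in S/K. *)
Definition quot_degree K f (t : nat) : Prop :=
  ~ K (pihomog mdeg t f) /\
  (forall s, (t < s)%N -> K (pihomog mdeg s f)).

Definition in_omega K f : Prop :=
  in_sigma K f /\
  exists2 t, quot_degree K f t
           & forall g s, in_sigma K g -> quot_degree K g s -> (s <= t)%N.

Definition in_w K f : Prop := (exists t : nat, f \is t.-homog) /\ in_omega K f.

(* p i is the exponent of the pure power of the variable i among the minimal
   generators, x is the distinguished variable with p x = d; the y's are the
   other variables with exponent d and the z's those with smaller exponent. *)
Section MBar.
Variables (d : nat) (p : 'I_n -> nat) (x : 'I_n).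

Definition Y_ideal : S -> Prop :=
  ideal_gen (fun f => exists2 i : 'I_n, (i != x) && (p i == d) & f = 'X_i ^+ d).

Definition Z_ideal : S -> Prop :=
  ideal_gen (fun f => exists2 i : 'I_n, (p i < d)%N & f = 'X_i ^+ p i).

(* The exponent of x in the monomial u is m_x d + o_x with m_x = u x %/ d. *)
Definition is_mbar (m : nat) u (b : int) : Prop :=
  exists tY tZ : nat,
    [/\ is_ord Y_ideal 'X_[u] tY, is_ord Z_ideal 'X_[u] tZ
      & b = m%:Z - (u x %/ d)%N%:Z - tY%:Z - tZ%:Z].

Definition is_min_mbar K (m : nat) (mu : int) : Prop :=
  (exists2 u, in_w K 'X_[u] & is_mbar m u mu) /\
  (forall u b, in_w K 'X_[u] -> is_mbar m u b -> mu <= b).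

End MBar.
End Ideals.

(* Main.v *)
Require Import Defs.
From mathcomp Require Import all_boot all_order all_algebra.
From mathcomp Require Import zify.
From Stdlib Require Import Classical.
Import Order.TTheory GRing.Theory Num.Theory.
Local Open Scope ring_scope.
Set Implicit Arguments.
Unset Strict Implicit.
Unset Printing Implicit Defensive.

(** Regularity is turned into a top degree, and the rest is a count of
    exponents.

    Homological half. If the quotient by [K] has finite length and top
    degree [T], then [reg K = T + 1] ([regularity_topdeg]). Take a minimal
    graded free resolution of the quotient and reduce it modulo the
    variables one at a time. The exact sequences for multiplication by the
    next variable show that modulo the first [j] variables the [i]-th
    homology vanishes in degrees above [T + i] ([koszul_vanishing]), and
    that a form of degree [T] outside [K] produces a nonzero class of degree
    [T + j] in the [j]-th homology ([koszul_socle]). Modulo all variables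
    the differentials are zero by minimality, so these two facts are
    statements about the degrees of the bases.

    Combinatorial half. Let [u] be a monomial of top degree outside [I^m],
    with exponents [u_i = q_i p_i + o_i] where [o_i < p_i], and let [b] be
    [m] minus the sum of the [q_i]; this is the value of mbar at [u].
    Suppose [e (m + 1) < e m]. Then all monomials of degree at least [deg u
    + d] lie in [I^(m+1)]. Fix a variable [v] with [p_v = d] and let [B_t]
    be the monomial whose exponent is [t d + o_v] at [v] and [o_i]
    elsewhere. For [t = q_v], [B_t] is not in [I^(t + b)], since the other
    pure powers dividing [u] would then put [u] in [I^m]. For [t = m - b +
    1], [B_t] is in [I^(t + b)] because its degree is large enough. Hence
    for some [t >= q_v] we have [B_t] outside [I^(t + b)] and [B_(t+1)]
    inside [I^(t + 1 + b)]. In a factorization of [B_(t+1)] no factor can be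
    divisible by the [d]-th power of [v], so comparing exponents of [v]
    gives [(t + 1) d + o_v <= (t + 1 + b) (d - 1)], and therefore [q_v + o_v
    < b (d - 1)] ([exponent_bound]).

    On the other hand [deg u >= d m - 1], because [x^(d m - 1)] is outside
    [I^m]. This and the bounds on all [q_v + o_v] force [m] to be at most
    the bound of the theorem ([defect_bound]), with [b] in place of [mu].
    Finally [p_i <= d] for all [i] because [I] is integral over its part of
    degree at most [d] ([pure_exponent_le]). *)

(** * Polynomials supported on a set of monomials *)

Section Support.
Variables (k : fieldType) (n : nat).
Local Notation S := {mpoly k[n]}.
Implicit Types (U V W : 'X_{1..n} -> Prop) (f g : S) (u v : 'X_{1..n}).

Definition supp_in U f : Prop := forall u, u \in msupp f -> U u.

Definition upset U : Prop := forall u v, (u <= v)%MM -> U u -> U v.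

Lemma supp_in_sub U V f : supp_in U f -> (forall u, U u -> V u) -> supp_in V f.
Proof. by move=> Uf UV u /Uf /UV. Qed.

Lemma supp_in0 U : supp_in U 0.
Proof. by move=> u; rewrite msupp0. Qed.

Lemma supp_inD U f g : supp_in U f -> supp_in U g -> supp_in U (f + g).
Proof. by move=> Uf Ug u /msuppD_le; rewrite mem_cat => /orP[/Uf|/Ug]. Qed.

Lemma supp_inN U f : supp_in U f -> supp_in U (- f).
Proof. by move=> Uf u; rewrite (perm_mem (msuppN f)) => /Uf. Qed.

Lemma supp_inB U f g : supp_in U f -> supp_in U g -> supp_in U (f - g).
Proof. by move=> Uf /supp_inN; apply: supp_inD. Qed.

Lemma supp_in_sum U (T : eqType) (r : seq T) (P : pred T) (F : T -> S) :
  (forall i, i \in r -> P i -> supp_in U (F i)) ->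
  supp_in U (\sum_(i <- r | P i) F i).
Proof.
move=> UF; rewrite big_seq_cond; elim/big_ind: _ => [|f g|i /andP[ir Pi]].
- exact: supp_in0.
- exact: supp_inD.
- exact: UF.
Qed.

Lemma supp_inMM U V W f g : (forall u v, U u -> V v -> W (u + v)%MM) ->
  supp_in U f -> supp_in V g -> supp_in W (f * g).
Proof.
move=> UVW Uf Vg w /msuppM_le /allpairsP[[u v] /= [uf vg ->]].
by apply: UVW; [apply: Uf | apply: Vg].
Qed.

Lemma supp_inM U f g : upset U -> supp_in U g -> supp_in U (f * g).
Proof.
move=> upU; apply: (@supp_inMM (fun=> True)) => // u v _; apply: upU.
exact: lem_addl.
Qed.

Lemma supp_inX U u : supp_in U 'X_[u] <-> U u.
Proof.
split=> [|Uu v]; first by apply; rewrite msuppX inE.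
by rewrite msuppX inE => /eqP->.
Qed.

Lemma supp_in_ideal U : upset U -> is_ideal (supp_in U).
Proof.
move=> upU; split=> *; [exact: supp_in0 | exact: supp_inD | exact: supp_inM].
Qed.

Lemma ideal_sum (J : S -> Prop) (T : eqType) (r : seq T) (F : T -> S) :
  is_ideal J -> (forall i, i \in r -> J (F i)) -> J (\sum_(i <- r) F i).
Proof.
move=> [J0 JD _] JF; rewrite big_seq.
by elim/big_ind: _ => // f g; apply: JD.
Qed.

Lemma ideal_gen_min (G J : S -> Prop) f : is_ideal J ->
  (forall g, G g -> J g) -> ideal_gen G f -> J f.
Proof.
move=> idJ GJ [s [Gs ->]]; apply: ideal_sum => // c /Gs /GJ.
by case: idJ => _ _ JM; apply: JM.
Qed.

Lemma mem_ideal_gen (G : S -> Prop) c f : G f -> ideal_gen G (c * f).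
Proof.
move=> Gf; exists [:: (c, f)]; split; last by rewrite big_seq1.
by move=> d; rewrite inE => /eqP->.
Qed.

Lemma ideal_gen_ideal (G : S -> Prop) : is_ideal (ideal_gen G).
Proof.
split=> [|f g [s [Gs ->]] [t [Gt ->]]|f g [s [Gs ->]]].
- by exists [::]; rewrite big_nil.
- exists (s ++ t); rewrite big_cat; split=> // c.
  by rewrite mem_cat => /orP[/Gs|/Gt].
- exists [seq (f * c.1, c.2) | c <- s]; split=> [_ /mapP[c /Gs Gc ->] //|].
  by rewrite big_map mulr_sumr; apply: eq_bigr => c _; rewrite mulrA.
Qed.

(** A polynomial is a combination of the monomials in its support. *)
Lemma supp_in_min U (J : S -> Prop) f : is_ideal J ->
  (forall u, U u -> J 'X_[u]) -> supp_in U f -> J f.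
Proof.
move=> idJ UJ Uf; rewrite [f]mpolyE; apply: ideal_sum => // u /Uf /UJ Ju.
by rewrite -mul_mpolyC; case: idJ => _ _; apply.
Qed.

Definition mfilt (c : pred 'X_{1..n}) f : S :=
  \sum_(u <- msupp f | c u) f@_u *: 'X_[u].

Lemma mfiltE (c : pred 'X_{1..n}) f : f = mfilt c f + mfilt (predC c) f.
Proof. by rewrite {1}[f]mpolyE (bigID c). Qed.

Lemma mfilt_supp (c : pred 'X_{1..n}) f :
  supp_in (fun u => u \in msupp f /\ c u) (mfilt c f).
Proof.
by apply: supp_in_sum => u uf cu v /msuppZ_le; rewrite msuppX inE => /eqP->.
Qed.

(** The monomials in the ideal generated by the first [j] variables. *)
Definition hits (j : nat) u : Prop := exists2 a : 'I_n, (a < j)%N & u a != 0%N.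

Lemma hits_upset j : upset (hits j).
Proof.
move=> u v /mnm_lepP uv [a aj ua]; exists a => //.
by rewrite -lt0n (leq_trans _ (uv a)) // lt0n.
Qed.

Lemma hits0 f : supp_in (hits 0) f -> f = 0.
Proof.
move=> hf; apply: msuppnil0; case E: (msupp f) => [//|u s].
by have [|a] := hf u; first by rewrite E mem_head.
Qed.

Lemma hitsS j u : hits j u -> hits j.+1 u.
Proof. by case=> a aj ua; exists a => //; apply: leqW. Qed.

Lemma max_ideal_hits f : max_ideal f <-> supp_in (hits n) f.
Proof.
split=> [|hf].
  apply: ideal_gen_min; first exact/supp_in_ideal/hits_upset.
  by move=> _ [i ->]; apply/supp_inX; exists i; rewrite ?ltn_ord // mnm1E eqxx.
apply: supp_in_min (hf); first exact: ideal_gen_ideal.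
move=> u [a _ ua]; have le: (U_(a) <= u)%MM.
  by apply/mnm_lepP=> i; rewrite mnm1E; case: eqP => // <-; rewrite lt0n.
by rewrite -(submK le) mpolyXD; apply: mem_ideal_gen; exists a.
Qed.

(** Together with the part of [f] free of the variable [a] this is division by
    that variable, see [xquoE]. *)
Definition xquo (a : 'I_n) f : S :=
  \sum_(u <- msupp f | u a != 0%N) f@_u *: 'X_[u - U_(a)].

Lemma xquoE a f : f = mfilt (fun u => u a == 0%N) f + 'X_a * xquo a f.
Proof.
rewrite {1}[f](mfiltE (fun u => u a == 0%N)); congr (_ + _).
rewrite /xquo mulr_sumr; apply: eq_bigr => u ua.
rewrite -scalerAr -mpolyXD addmC submK //.
by apply/mnm_lepP=> i; rewrite mnm1E; case: eqP => // <-; rewrite lt0n.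
Qed.

Lemma xquo_supp U f a : supp_in U f ->
  supp_in (fun u => U (U_(a) + u)%MM) (xquo a f).
Proof.
move=> Uf; apply: supp_in_sum => u uf ua v /msuppZ_le.
rewrite msuppX inE => /eqP->.
rewrite addmC submK; first exact: Uf.
by apply/mnm_lepP=> i; rewrite mnm1E; case: eqP => // <-; rewrite lt0n.
Qed.

Lemma mfilt_hits f (a : 'I_n) : supp_in (hits a.+1) f ->
  supp_in (hits a) (mfilt (fun u => u a == 0%N) f).
Proof.
move=> hf u /mfilt_supp [/hf [b]].
rewrite ltnS leq_eqVlt => /orP[/eqP/val_inj->|ba].
  by move=> /negPf->.
by exists b.
Qed.

(** The variables form a regular sequence: the variable number [a] is a
    nonzerodivisor modulo the earlier ones. *)
Lemma hits_XM f (a : 'I_n) : supp_in (hits a) ('X_a * f) -> supp_in (hits a) f.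
Proof.
move=> hf u uf; have [|b ba] := hf (U_(a) + u)%MM.
  rewrite mulrC (perm_mem (msuppMX _ _)); apply/mapP; exists u => //.
rewrite mnmDE mnm1E; case: (a =P b) ba => [->|_ ba]; first by rewrite ltnn.
by exists b.
Qed.

End Support.

(** * Homology of a graded free complex modulo variables *)

Section Complex.
Variables (k : fieldType) (n : nat).
Local Notation S := {mpoly k[n]}.
Implicit Types (f g : S) (u : 'X_{1..n}).

(** Elements of degree at least [s] in the graded free module whose basis
    has degrees [sh]. Lower bounds on degrees are enough for the whole
    argument and, unlike homogeneity, ask nothing about individual
    components. *)
Definition vgeq r (sh : 'I_r -> nat) (s : nat) (v : 'rV[S]_r) : Prop :=
  forall t, supp_in (fun u => s <= mdeg u + sh t)%N (v 0 t).

(** Vectors that vanish modulo the first [j] variables. *)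
Definition vhits r (j : nat) (v : 'rV[S]_r) : Prop :=
  forall t, supp_in (hits j) (v 0 t).

Lemma vgeqB r (sh : 'I_r -> nat) s v w :
  vgeq sh s v -> vgeq sh s w -> vgeq sh s (v - w).
Proof. by move=> hv hw t; rewrite !mxE; apply: supp_inB. Qed.

Lemma vgeqX r (sh : 'I_r -> nat) s v (a : 'I_n) :
  vgeq sh s.-1 v -> vgeq sh s ('X_a *: v).
Proof.
move=> hv t; rewrite !mxE.
apply: (supp_inMM (U := fun u => u = U_(a)%MM) _ _ (hv t)); last exact/supp_inX.
by move=> u w ->; rewrite mdegD mdeg1; lia.
Qed.

Lemma vhitsB r j (v w : 'rV[S]_r) : vhits j v -> vhits j w -> vhits j (v - w).
Proof. by move=> hv hw t; rewrite !mxE; apply: supp_inB. Qed.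

Lemma vhitsD r j (v w : 'rV[S]_r) : vhits j v -> vhits j w -> vhits j (v + w).
Proof. by move=> hv hw t; rewrite !mxE; apply: supp_inD. Qed.

Lemma vhits0 r j : vhits j (0 : 'rV[S]_r).
Proof. by move=> t; rewrite mxE; apply: supp_in0. Qed.

Lemma vhits0P r (v : 'rV[S]_r) : vhits 0 v <-> v = 0.
Proof.
split=> [hv|->]; last exact: vhits0.
by apply/rowP=> t; rewrite mxE (hits0 (hv t)).
Qed.

Lemma vhitsS r j (v : 'rV[S]_r) : vhits j v -> vhits j.+1 v.
Proof. by move=> hv t; apply: (supp_in_sub (hv t)) => u; apply: hitsS. Qed.

Lemma vhitsZ r j f (v : 'rV[S]_r) : vhits j v -> vhits j (f *: v).
Proof. by move=> hv t; rewrite mxE; apply: supp_inM; [apply: hits_upset|]. Qed.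

Lemma vhitsX r (a : 'I_n) (v : 'rV[S]_r) : vhits a.+1 ('X_a *: v).
Proof.
move=> t; rewrite mxE mulrC; apply: supp_inM; first exact: hits_upset.
by apply/supp_inX; exists a; rewrite // mnm1E eqxx.
Qed.

Lemma vhits_XZ r (a : 'I_n) (v : 'rV[S]_r) : vhits a ('X_a *: v) -> vhits a v.
Proof. by move=> hv t; apply: hits_XM; move: (hv t); rewrite mxE. Qed.

Lemma vhitsM r r' j (v : 'rV[S]_r) (D : 'M_(r, r')) :
  vhits j v -> vhits j (v *m D).
Proof.
move=> hv t; rewrite mxE; apply: supp_in_sum => i _ _.
by rewrite mulrC; apply: supp_inM; [apply: hits_upset | apply: hv].
Qed.

Lemma vhits_split r (sh : 'I_r -> nat) s (a : 'I_n) (v : 'rV[S]_r) :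
  vhits a.+1 v -> vgeq sh s v ->
  exists2 w, vgeq sh s.-1 w & vhits a (v - 'X_a *: w).
Proof.
move=> hv gv; exists (map_mx (xquo a) v) => t; rewrite !mxE.
  apply: (supp_in_sub (xquo_supp (gv t))) => u.
  by rewrite mdegD mdeg1; lia.
by rewrite {1}[v 0 t](xquoE a) addrK; apply: mfilt_hits.
Qed.

Variables (rk : nat -> nat) (sh : forall i, 'I_(rk i) -> nat).
Variable (D : forall i, 'M[S]_(rk i.+1, rk i)).

Hypothesis D_homog : forall i j j', D i j j' = 0 \/
    exists2 s : nat, D i j j' \is s.-homog & (s + sh j')%N = sh j.
Hypothesis D_exact : forall i (v : 'rV[S]_(rk i.+1)),
    v *m D i = 0 <-> exists w, v = w *m D i.+1.

Lemma DD i (v : 'rV[S]_(rk i.+2)) : v *m D i.+1 *m D i = 0.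
Proof. by apply/D_exact; exists v. Qed.

(** A degree-preserving map sends each graded piece to the piece of the same
    degree; [P] selects a set of degrees. *)
Lemma supp_D (P : nat -> Prop) i (v : 'rV[S]_(rk i.+1)) :
  (forall t, supp_in (fun u => P (mdeg u + sh t)%N) (v 0 t)) ->
  forall t, supp_in (fun u => P (mdeg u + sh t)%N) ((v *m D i) 0 t).
Proof.
move=> hv t; rewrite mxE; apply: supp_in_sum => j _ _.
have [->|[s /dhomogP hs e]] := D_homog j t.
  by rewrite mulr0; apply: supp_in0.
apply: (supp_inMM (V := fun u => mdeg u = s) _ (hv j)) => [u w Pu ew|u /hs //].
by rewrite mdegD -addnA [(mdeg w + _)%N](_ : _ = sh j) // ew.
Qed.

(** Only the part of a preimage in degrees at least [s] contributes in those
    degrees, so a preimage can be truncated. *)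
Lemma graded_lift i s (v : 'rV[S]_(rk i)) (w : 'rV[S]_(rk i.+1)) :
  vgeq (@sh i) s v -> v = w *m D i ->
  exists2 w', vgeq (@sh i.+1) s w' & v = w' *m D i.
Proof.
move=> gv ev; pose c t (u : 'X_{1..n}) := (s <= mdeg u + sh t)%N.
pose w1 := \row_t mfilt (@c _ t) (w 0 t).
pose w2 := \row_t mfilt (predC (@c _ t)) (w 0 t).
have w1_geq : vgeq (@sh i.+1) s w1.
  by move=> t; rewrite mxE; apply: (supp_in_sub (@mfilt_supp _ _ _ _)) => u [].
have ew : w = w1 + w2 by apply/rowP=> t; rewrite !mxE; apply: mfiltE.
exists w1 => //; have e2 : v - w1 *m D i = w2 *m D i.
  by rewrite ev ew mulmxDl addrC addKr.
suff: w2 *m D i = 0 by rewrite -e2 => /eqP; rewrite subr_eq0 => /eqP.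
have lt2 : forall t, supp_in (fun u => mdeg u + sh t < s)%N ((w2 *m D i) 0 t).
  apply: (supp_D (P := fun d => d < s)%N) => t; rewrite mxE.
  by apply: (supp_in_sub (@mfilt_supp _ _ _ _)) => u [_ /=]; rewrite /c -ltnNge.
have ge2 : forall t, supp_in (fun u => s <= mdeg u + sh t)%N ((w2 *m D i) 0 t).
  rewrite -e2; apply: vgeqB => //; exact: (supp_D (P := leq s)).
apply/rowP=> t; rewrite [RHS]mxE; apply: msuppnil0.
case E: (msupp _) => [//|u q]; have um: u \in msupp ((w2 *m D i) 0 t).
  by rewrite E mem_head.
by have := lt2 t u um; have := ge2 t u um; rewrite ltnNge => ->.
Qed.

(** The cokernel of [D 0] vanishes in degrees above [T]. *)
Definition top_bound (T : nat) : Prop :=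
  forall v : 'rV[S]_(rk 0), vgeq (@sh 0) T.+1 v -> exists w, v = w *m D 0.

(** Let [G_j] be the complex [D] modulo the first [j] variables. The
    homology [H_(i+1)(G_j)] vanishes if [j <= i], and in degrees above [T +
    i + 1] if the cokernel of [D 0] lives in degrees at most [T]. This
    follows by adding one variable at a time: multiplication by the next
    variable [x_j] gives an exact sequence from [H_(i+1)(G_j)] to
    [H_(i+1)(G_(j+1))] to [H_i(G_j)], and the last map lowers degrees by
    one. The proof is the corresponding diagram chase on representatives. *)
Lemma koszul_vanishing j i s (v : 'rV[S]_(rk i.+1)) : (j <= n)%N ->
  (j <= i)%N \/ (exists2 T, top_bound T & (T + i.+1 < s)%N) ->
  vgeq (@sh i.+1) s v -> vhits j (v *m D i) ->
  exists2 u, vgeq (@sh i.+2) s u & vhits j (v - u *m D i.+1).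
Proof.
elim: j i s v => [|j IHj] i s v.
  move=> _ _ gv /vhits0P /D_exact [w ew].
  have [u gu eu] := graded_lift gv ew; exists u => //.
  by apply/vhits0P; rewrite -eu subrr.
move=> ltjn range gv hv; pose a := Ordinal ltjn.
have gDv : vgeq (@sh i) s (v *m D i) by apply: (supp_D (P := leq s)).
(* [w] represents the image of [v] under the connecting map. *)
have [w gw hw] := @vhits_split _ _ _ a _ hv gDv.
have [y gy hy] : exists2 y, vgeq (@sh i.+1) s.-1 y & vhits j (w - y *m D i).
  case: i => [|i] in v gv hv range gDv w gw hw *.
    have [T D_top lt_s] : exists2 T, top_bound T & (T.+1 <= s.-1)%N.
      by case: range => // -[T top ltT]; exists T => //; lia.
    have [y ey] : exists y, w = y *m D 0.
      by apply: D_top => t; apply: (supp_in_sub (gw t)) => u; apply: leq_trans.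
    have [y' gy ey'] := graded_lift gw ey.
    by exists y'; rewrite // -ey' subrr; apply: vhits0.
  apply: IHj => //; first exact: ltnW.
    by case: range => [?|[T top ltT]]; [left; lia | right; exists T => //; lia].
  apply: (@vhits_XZ _ a); rewrite scalemxAl.
  have := vhitsM (D := D i) hw; rewrite mulmxBl DD sub0r => h t.
  by have := supp_inN (h t); rewrite mxE opprK.
(* Correcting [v] by the bounding chain [y] leaves a cycle of [G_j]. *)
have gXy : vgeq (@sh i.+1) s ('X_a *: y) by apply: vgeqX.
have [z gz hz] : exists2 z, vgeq (@sh i.+2) s z
    & vhits j (v - 'X_a *: y - z *m D i.+1).
  apply: IHj; [exact: ltnW | | exact: vgeqB |].
    by case: range => [?|[T top ltT]]; [left; lia | right; exists T => //; lia].
  rewrite mulmxBl -scalemxAl.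
  rewrite (_ : _ - _ = (v *m D i - 'X_a *: w) + 'X_a *: (w - y *m D i)).
    by apply: vhitsD => //; apply: vhitsZ.
  by rewrite scalerBr addrA subrK.
exists z => //; rewrite (_ : _ - _ = (v - 'X_a *: y - z *m D i.+1) + 'X_a *: y).
  by apply: vhitsD; [apply: vhitsS | apply: (@vhitsX _ a)].
by rewrite addrAC subrK.
Qed.

(** A socle element [v0] of degree [T] in the cokernel of [D 0] produces a
    nonzero socle class of degree [T + j] in [H_j(G_j)], for every [j].
    Since the class [v] in [H_j(G_j)] is killed by the next variable, that
    multiple bounds some chain [u], which is a cycle of [G_(j+1)]; its class
    is nonzero because the connecting map sends it back to [v]. *)
Lemma koszul_socle T (v0 : 'rV[S]_(rk 0)) :
  vgeq (@sh 0) T v0 -> ~ (exists w, v0 = w *m D 0) ->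
  (forall a, exists w, 'X_a *: v0 = w *m D 0) ->
  forall j, (j <= n)%N -> exists v : 'rV[S]_(rk j),
    [/\ vgeq (@sh j) (T + j) v, ~ (exists w, vhits j (v - w *m D j))
      & forall a, exists2 w, vgeq (@sh j.+1) (T + j.+1) w
                           & vhits j ('X_a *: v - w *m D j)].
Proof.
move=> g0 nz0 soc0; elim=> [_|j IHj ltjn].
  exists v0; split=> [||a]; first by rewrite addn0.
    case=> w /vhits0P /eqP; rewrite subr_eq0 => /eqP ew.
    by apply: nz0; exists w.
  have [w ew] := soc0 a.
  have [|w' gw ew'] := @graded_lift 0 (T + 1) ('X_a *: v0) w _ ew.
    by apply: vgeqX; rewrite addn1.
  by exists w' => //; rewrite ew' subrr; apply: vhits0.
have [v [gv nzv socv]] := IHj (ltnW ltjn); pose a := Ordinal ltjn.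
have [u gu hu] := socv a; exists u; split=> // [[w hw]|b].
  have [t gt ht] := @vhits_split _ (@sh j.+1) 0 a _ hw (fun _ _ _ => isT).
  apply: nzv; exists t; apply: (@vhits_XZ _ a).
  have ht' := vhitsM (D := D j) ht.
  rewrite (_ : _ *: _ = ('X_a *: v - u *m D j)
                        + (u - w *m D j.+1 - 'X_a *: t) *m D j).
    exact: vhitsD.
  by rewrite !mulmxBl DD subr0 -scalemxAl scalerBr addrA subrK.
(* [x_b u - x_a y] is a cycle of [G_j] in homological degree [j + 1], where the
   homology vanishes, so [x_b u] bounds modulo [x_a]. *)
have [y gy hy] := socv b.
have [||||z gz hz] :=
  @koszul_vanishing j j (T + j.+2) ('X_b *: u - 'X_a *: y).
- exact: ltnW.
- by left.
- by apply: vgeqB; apply: vgeqX; rewrite addnS.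
- rewrite mulmxBl -!scalemxAl.
  rewrite (_ : _ - _ = 'X_a *: ('X_b *: v - y *m D j)
                       - 'X_b *: ('X_a *: v - u *m D j)).
    by apply: vhitsB; apply: vhitsZ.
  by rewrite !scalerBr !scalerA [_ * 'X_b]mulrC opprB [RHS]addrC subrKA.
exists z => //.
rewrite (_ : _ - _ = ('X_b *: u - 'X_a *: y - z *m D j.+1) + 'X_a *: y).
  by apply: vhitsD; [apply: vhitsS | apply: (@vhitsX _ a)].
by rewrite addrAC subrK.
Qed.

End Complex.

(** * Regularity and top degree *)

Section Regularity.
Variables (k : fieldType) (n : nat) (K : {mpoly k[n]} -> Prop).
Variable F : min_graded_res K.
Local Notation S := {mpoly k[n]}.

(** The resolution of [K] extended by the ambient ring in homological degree 0,
    so that the cokernel of [aug_D 0] is the quotient by [K]. *)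
Definition aug_rank (i : nat) : nat := if i is i'.+1 then res_rank F i' else 1.

Definition aug_shift (i : nat) : 'I_(aug_rank i) -> nat :=
  if i is i'.+1 then @res_shift _ _ _ F i' else fun=> 0%N.

Definition aug_D (i : nat) : 'M[S]_(aug_rank i.+1, aug_rank i) :=
  if i is i'.+1 then res_diff F i' else res_aug F.

Lemma aug_D_homog i j j' : aug_D i j j' = 0 \/
  exists2 s : nat, aug_D i j j' \is s.-homog
                 & (s + aug_shift j')%N = aug_shift j.
Proof.
case: i j j' => [|i] j j' /=; last exact: res_diff_homog.
right; rewrite ord1; exists (res_shift j); rewrite ?addn0 //.
exact: res_aug_homog.
Qed.

Lemma aug_D_exact i (v : 'rV[S]_(aug_rank i.+1)) :
  v *m aug_D i = 0 <-> exists w, v = w *m aug_D i.+1.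
Proof. by case: i v => [|i] v; [apply: res_exact0 | apply: res_exactS]. Qed.

Lemma aug_D0P f : K f <-> exists w, (f%:M : 'rV[S]_1) = w *m aug_D 0.
Proof.
rewrite res_aug_image; split=> -[w e]; exists w.
  by rewrite e [RHS]mx11_scalar.
by have := congr1 (fun M : 'M_1 => M 0 0) e; rewrite /= mxE.
Qed.

Lemma mdeg_gt0_hits (u : 'X_{1..n}) : (0 < mdeg u)%N -> hits n u.
Proof.
rewrite mdegE lt0n sum_nat_eq0 => /forallPn[a]; rewrite implyTb => ua.
by exists a.
Qed.

Lemma homog_hits (f : S) s : (0 < s)%N -> f \is s.-homog -> supp_in (hits n) f.
Proof.
move=> s_gt0 /dhomogP hf u uf; apply: mdeg_gt0_hits.
by have -> : mdeg u = s by apply: hf.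
Qed.

(** A basis element of too large degree would, by minimality (for the
    augmentation, by its degree), be a cycle modulo the variables, hence by
    [koszul_vanishing] a boundary modulo the variables; but by minimality
    again boundaries vanish modulo the variables. *)
Lemma shift_le T : (forall f : S, supp_in (fun u => T < mdeg u)%N f -> K f) ->
  forall i (j : 'I_(res_rank F i)), (res_shift j <= T.+1 + i)%N.
Proof.
move=> topK i j; rewrite leqNgt; apply/negP => lt_j.
pose v : 'rV[S]_(aug_rank i.+1) := delta_mx 0 j.
have vE t : v 0 t = (t == j)%:R by rewrite mxE eqxx.
have top : top_bound aug_shift aug_D T.
  move=> w gw; have [|w' ew] := (aug_D0P (w 0 0)).1.
    by apply: topK; apply: (supp_in_sub (gw 0)) => u /=; rewrite addn0.
  by exists w'; rewrite -ew -mx11_scalar.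
have [||||u _ hu] := @koszul_vanishing _ _ _ _ _ aug_D_homog aug_D_exact
  n i (res_shift j) v.
- by [].
- by right; exists T => //; move: lt_j; lia.
- move=> t; rewrite vE; case: eqP => [->|_]; last exact: supp_in0.
  by move=> u _; apply: leq_addl.
- move=> t; rewrite -rowE mxE.
  case: i j @v vE lt_j t => [|i] j v vE lt_j t.
    rewrite (ord1 t); apply: (homog_hits _ (res_aug_homog j)).
    by move: lt_j; lia.
  exact/max_ideal_hits/res_minimal.
have h : supp_in (hits n) (1 : S).
  have -> : 1 = (v - u *m aug_D i.+1) 0 j + (u *m aug_D i.+1) 0 j.
    by rewrite -[LHS]/(true%:R) -(eqxx j) -vE mxE [in LHS]/= !mxE subrK.
  apply: supp_inD; first exact: hu.
  rewrite mxE; apply: supp_in_sum => t _ _; apply: supp_inM.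
    exact: hits_upset.
  exact/max_ideal_hits/res_minimal.
by have [|a _] := h 0%MM; rewrite ?msupp1 ?inE // mnm0E.
Qed.

(** The class given by [koszul_socle] for all [n] variables is a vector of
    degree at least [T + n] that does not vanish modulo the variables, so
    some basis element of that homological degree has degree at least [T +
    n]. *)
Lemma shift_ge T (f : S) : (0 < n)%N -> supp_in (fun u => T <= mdeg u)%N f ->
  ~ K f -> (forall a : 'I_n, K ('X_a * f)) ->
  exists i, exists j : 'I_(res_rank F i), (T.+1 + i <= res_shift j)%N.
Proof.
move=> n_gt0 degf nKf socf.
have n1n : (n.-1.+1 <= n)%N by rewrite prednK.
have [||a|v [gv nzv _]] := @koszul_socle _ _ _ _ _ aug_D_homog aug_D_exact
  T f%:M _ _ _ n.-1.+1 n1n.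
- move=> t; rewrite (ord1 t) mxE mulr1n.
  by apply: (supp_in_sub degf) => u; rewrite addn0.
- by move/aug_D0P.
- have [w ew] := (aug_D0P _).1 (socf a).
  by exists w; rewrite -ew scale_scalar_mx.
exists n.-1; apply: NNPP => lt_sh; apply: nzv; exists 0.
rewrite mul0mx subr0 => t u ut.
have lt_t : (res_shift t < T.+1 + n.-1)%N.
  by rewrite ltnNge; apply/negP => ?; apply: lt_sh; exists t.
have deg_u : (0 < mdeg u)%N by have := gv t u ut; move: lt_t => /=; lia.
by rewrite prednK //; apply: mdeg_gt0_hits.
Qed.

End Regularity.

(** A form of top degree is a socle element, so the bounds of [shift_le] and
    [shift_ge] meet. *)
Lemma regularity_topdeg (k : fieldType) (n : nat) (K : {mpoly k[n]} -> Prop)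
    (T : nat) (f : {mpoly k[n]}) (r : int) : (0 < n)%N ->
  (forall g : {mpoly k[n]}, supp_in (fun u => T < mdeg u)%N g -> K g) ->
  supp_in (fun u => T <= mdeg u)%N f -> ~ K f ->
  is_regularity K r -> r = T.+1%:Z.
Proof.
move=> n_gt0 topK degf nKf [F [[i [j ->]] le_r]].
have [a|i' [j' le_j']] := shift_ge F n_gt0 degf nKf.
  apply: topK; apply: (supp_inMM (U := fun u => u = U_(a)%MM) _ _ degf).
    by move=> u v ->; rewrite mdegD mdeg1.
  exact/supp_inX.
have := shift_le (F := F) topK j; have := le_r i' j'; lia.
Qed.

(** * Powers of monomial ideals *)

Section MonomialPowers.
Variable n : nat.
Implicit Types (N : 'X_{1..n} -> Prop) (u v w : 'X_{1..n}).

(** The exponents of the monomials in the [t]-th power of the monomial ideal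
    whose monomials have their exponents in [N]. An exact sum suffices
    because [N] is meant to be an upset. *)
Fixpoint mpow N (t : nat) u : Prop :=
  if t is t'.+1 then exists v w, [/\ N v, mpow N t' w & u = (v + w)%MM]
  else True.

Lemma mpow_upset N t : upset N -> upset (mpow N t).
Proof.
case: t => // t upN u u' /submK <- [v [w [Nv Nw ->]]].
exists (u' - (v + w) + v)%MM, w; split=> //; last by rewrite addmA.
by apply: upN Nv; apply: lem_addl.
Qed.

Lemma mpowS N t u : upset N -> mpow N t.+1 u -> mpow N t u.
Proof.
by move=> upN [v [w [_ Nw ->]]]; apply: (mpow_upset upN) Nw; apply: lem_addl.
Qed.

Lemma mpow_leq N s t u : upset N -> (s <= t)%N -> mpow N t u -> mpow N s u.
Proof.
move=> upN; elim: t => [|t IHt]; first by rewrite leqn0 => /eqP->.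
by rewrite leq_eqVlt => /orP[/eqP->//|/IHt IH /(mpowS upN)].
Qed.

Lemma mpowD N s t u v : mpow N s u -> mpow N t v -> upset N ->
  mpow N (s + t) (u + v)%MM.
Proof.
move=> Nu Nv upN; elim: s u Nu => [|s IHs] u.
  by move=> _; apply: (mpow_upset upN) Nv; apply: lem_addl.
case=> u1 [u2 [Nu1 Nu2 ->]]; exists u1, (u2 + v)%MM.
by split; [| apply: IHs | rewrite addmA].
Qed.

Lemma mpow_muln N c u : N u -> mpow N c (u *+ c)%MM.
Proof.
move=> Nu; elim: c => //= c IHc; exists u, (u *+ c)%MM; split=> //.
exact: mulmS.
Qed.

Lemma mpow_quot N (p : 'I_n -> nat) (Q : pred 'I_n) u : upset N ->
  (forall i, Q i -> N (U_(i) *+ p i)%MM) ->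
  mpow N (\sum_(i | Q i) u i %/ p i) u.
Proof.
move=> upN Np.
have: mpow N (\sum_(i | Q i) u i %/ p i)
             (\sum_(i | Q i) (U_(i) *+ p i) *+ (u i %/ p i))%MM.
  elim/big_ind2: _ => // [t1 v1 t2 v2 N1 N2|i /Np Ni]; first exact: mpowD.
  exact: mpow_muln.
apply: (mpow_upset upN); apply/mnm_lepP=> j; rewrite mnm_sumE big_mkcond /=.
rewrite (bigD1 j) //= big1 => [|i neq_ij].
  by case: (Q j); rewrite // addn0 !mulmnE mnm1E eqxx mul1n mulnC leq_trunc_div.
by case: (Q i); rewrite // !mulmnE mnm1E (negPf neq_ij).
Qed.

(** Either some factor of a factorization is divisible by the [d]-th power
    of the variable [x], and dividing by it costs one factor only, or every
    factor, possibly after absorbing the cofactor, has degree at most [d -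
    1] in [x]. *)
Lemma mpow_drop N (x : 'I_n) d t u : upset N -> (0 < d)%N -> mpow N t.+1 u ->
  (u x <= d.-1 * t.+1)%N \/ (d <= u x)%N /\ mpow N t (u - U_(x) *+ d)%MM.
Proof.
move=> upN d_gt0; elim: t u => [|t IHt] u.
  by move=> _; case: (leqP d (u x)); [right | left; lia].
case=> v [w [Nv Nw ->]]; rewrite mnmDE; have [le_dv|lt_vd] := leqP d (v x).
  right; split; first exact: leq_trans (leq_addr _ _).
  have le: (U_(x) *+ d <= v)%MM.
    apply/mnm_lepP=> i; rewrite mulmnE mnm1E.
    by case: eqP => [<-|_]; rewrite ?mul1n ?mul0n.
  apply: (@mpow_upset N t.+1 upN w) => //.
  by apply/mnm_lepP=> i; rewrite mnmBE mnmDE; have := mnm_lepP le i; lia.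
case: (IHt _ Nw) => [le_w|[le_dw Nw']]; first by left; lia.
right; split; first exact: leq_trans (leq_addl _ _).
exists v, (w - U_(x) *+ d)%MM; split=> //.
apply/mnmP=> i; rewrite !(mnmBE, mnmDE, mulmnE, mnm1E).
by case: eqP => [<-|_]; lia.
Qed.

Section ExponentBound.
Variables (N : 'X_{1..n} -> Prop) (p : 'I_n -> nat) (d m b : nat).
Variables (u : 'X_{1..n}) (v : 'I_n).
Hypotheses (upN : upset N) (Np : forall i, N (U_(i) *+ p i)%MM).
Hypotheses (p_gt0 : forall i, (0 < p i)%N) (p_le : forall i, (p i <= d)%N).
Hypotheses (pv : p v = d) (em : m = (b + \sum_i u i %/ p i)%N).
Hypotheses (nNu : ~ mpow N m u).
Hypothesis topN : forall w, (mdeg u + d <= mdeg w)%N -> mpow N m.+1 w.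

(** The monomial [B_t] of the opening comment. All pure powers of [u] are
    given up in exchange for [t] copies of the one of [v], which turns the
    comparison of two powers of the ideal into a question about the single
    number [t]. *)
Definition refill (t : nat) : 'X_{1..n} :=
  [multinom (if i == v then t * d + u v %% d else u i %% p i)%N | i < n].

(** Otherwise the pure powers of the other variables that divide [u] would
    complete this to a membership of [u] in the [m]-th power. *)
Lemma refill_lower : ~ mpow N (u v %/ d + b) (refill (u v %/ d)).
Proof.
move=> NB; apply: nNu.
pose w := [multinom (if i == v then 0 else u i %/ p i * p i)%N | i < n].
have -> : u = (refill (u v %/ d) + w)%MM.
  apply/mnmP=> i; rewrite mnmDE !mnmE; case: eqP => [->|_].
    by rewrite addn0 -divn_eq.
  by rewrite addnC -divn_eq.
suff -> : m = (u v %/ d + b + \sum_(i | i != v) w i %/ p i)%N.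
  by apply: mpowD => //; apply: mpow_quot.
rewrite em (bigD1 v) //= pv addnCA addnA; congr (_ + _)%N.
by apply: eq_bigr => i /negPf neq; rewrite mnmE neq mulnK.
Qed.

Lemma mdeg_refill t : mdeg (refill t) = (t * d + \sum_i u i %% p i)%N.
Proof.
rewrite mdegE (bigD1 v) //= mnmE eqxx (bigD1 v (P := predT)) //= pv addnA.
by congr (_ + _)%N; apply: eq_bigr => i /negPf neq; rewrite mnmE neq.
Qed.

(** Trading all the pure powers dividing [u] for [d]-th powers does not decrease
    the degree. *)
Lemma refill_top : mpow N ((m - b).+1 + b) (refill (m - b).+1).
Proof.
rewrite [in (_ + b)%N]em addKn addSn addnC -em; apply: topN.
rewrite mdeg_refill em addKn mulSn -addnA [leqLHS]addnC leq_add2l.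
rewrite big_distrl -big_split mdegE.
apply: leq_sum => i _; rewrite {1}(divn_eq (u i) (p i)) leq_add2r.
by rewrite leq_mul2l p_le orbT.
Qed.

(** By [refill_lower] and [refill_top] there is some [s] such that [refill
    s] is outside the power [s + b] while [refill s.+1] is inside the next
    power. At this switch no factor contains the [d]-th power of [v], so
    [mpow_drop] bounds the exponent of [v] in [refill s.+1] by [(d - 1) * (s
    + b + 1)]. *)
Lemma exponent_bound : (u v %/ d + u v %% d < b * d.-1)%N.
Proof.
have d_gt0 : (0 < d)%N by rewrite -pv.
have [s [ge_s nNs NsS]] : exists s, [/\ (u v %/ d <= s)%N,
    ~ mpow N (s + b) (refill s) & mpow N (s.+1 + b) (refill s.+1)].
  apply: NNPP => none.
  suff nN j : ~ mpow N (u v %/ d + j + b) (refill (u v %/ d + j)).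
    apply: (nN ((m - b).+1 - u v %/ d)%N).
    rewrite subnKC; first exact: refill_top.
    by rewrite em (bigD1 v) //= pv; lia.
  elim: j => [|j IHj]; first by rewrite addn0; apply: refill_lower.
  rewrite addnS => NSj; apply: none; exists (u v %/ d + j)%N.
  by split; rewrite ?leq_addr.
rewrite addSn in NsS; case: (mpow_drop v upN d_gt0 NsS) => [|[_ Ns]].
  rewrite mnmE eqxx => le_s.
  have e : (s.+1 * d = s * d.-1 + s + d)%N by rewrite -{1 3}(prednK d_gt0); lia.
  by move: le_s; rewrite e; lia.
case: nNs; move: Ns; congr mpow; apply/mnmP=> i.
rewrite mnmBE mulmnE mnm1E !mnmE eq_sym; case: eqP => _; lia.
Qed.

End ExponentBound.
End MonomialPowers.

(** * Counting exponents *)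

(** Each exponent is [q * p i + o] with [o < p i]; if [p i < d] it is at
    most [(d - 1) * q + (d - 2)], and if [p i = d] the bound on [q + o]
    makes it at most [(d - 1) * q + b * (d - 1) - 1]. As the [q]'s add up to
    [m - b], summing gives an upper bound for the degree of [u], to be
    compared with [d * m - 1]. *)
Lemma defect_bound n (u : 'X_{1..n}) (p : 'I_n -> nat) (d m b : nat) :
  (forall i, 0 < p i)%N -> (forall i, p i <= d)%N ->
  m = (b + \sum_i u i %/ p i)%N ->
  (forall i, p i = d -> u i %/ d + u i %% d < b * d.-1)%N ->
  (d * m <= (mdeg u).+1)%N ->
  m%:Z <= (n%:Z - 1) * (d%:Z - 2)
          + (b%:Z - 1) * (#|[set i | p i == d]|%:Z - 1) * (d%:Z - 1).
Proof.
move=> p_gt0 p_le em le_exp ge_deg.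
set l := #|_|.
have le_i i : (u i)%:Z <= (d%:Z - 1) * (u i %/ p i)%N%:Z + ((d%:Z - 2)
    + if i \in [set i | p i == d] then (b%:Z - 1) * (d%:Z - 1) else 0).
  rewrite inE; case: eqP => [e|/eqP ne].
    have := le_exp i e; have := divn_eq (u i) (p i); rewrite e.
    have := p_gt0 i; rewrite e.
    move: (u i %/ d)%N (u i %% d)%N => q o d_gt0 eu h.
    have e1 : (q * d = q * d.-1 + q)%N by rewrite -{1}(prednK d_gt0); lia.
    by rewrite e1 in eu; lia.
  have lt_p : (p i < d)%N by rewrite ltn_neqAle ne p_le.
  have := ltn_pmod (u i) (p_gt0 i); have := divn_eq (u i) (p i).
  move: (u i %/ p i)%N (u i %% p i)%N => q o eu lt_o.
  have e1 : (q * p i <= q * d.-1)%N by rewrite leq_mul2l; lia.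
  by lia.
have : (mdeg u)%:Z <= (d%:Z - 1) * (m%:Z - b%:Z)
    + (n%:Z * (d%:Z - 2) + l%:Z * ((b%:Z - 1) * (d%:Z - 1))).
  rewrite mdegE [in X in _ <= X]em PoszD addrAC subrr add0r.
  rewrite !(big_morph Posz PoszD (erefl _)) mulr_sumr.
  apply: le_trans (ler_sum _ (fun i _ => le_i i)) _.
  rewrite big_split big_split /= -big_mkcond /= !sumr_const card_ord.
  have mulz (c : int) (t : nat) : c *+ t = t%:Z * c by rewrite -mulr_natl natz.
  by rewrite !mulz.
lia.
Qed.

(** * Ideals of polynomials and their monomials *)

Section Ideals.
Variables (k : fieldType) (n : nat).
Local Notation S := {mpoly k[n]}.
Implicit Types (I J : S -> Prop) (N : 'X_{1..n} -> Prop) (u v w : 'X_{1..n}).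

Lemma ideal_gen_monomials (M : 'X_{1..n} -> Prop) (f : S) :
  ideal_gen (fun g => exists2 u, M u & g = 'X_[u]) f
  <-> supp_in (fun u => exists2 v, M v & (v <= u)%MM) f.
Proof.
have up : upset (fun u => exists2 v, M v & (v <= u)%MM).
  by move=> u u' uu' [v Mv vu]; exists v => //; apply: lepm_trans uu'.
split.
  apply: ideal_gen_min; first exact: supp_in_ideal.
  by move=> _ [u Mu ->]; apply/supp_inX; exists u => //; apply: lepm_refl.
apply: supp_in_min; first exact: ideal_gen_ideal.
move=> u [v Mv le]; rewrite -(submK le) mpolyXD; apply: mem_ideal_gen.
by exists v.
Qed.

Lemma ideal_pow_supp I N t f : upset N -> (forall g, I g <-> supp_in N g) ->
  ideal_pow I t f <-> supp_in (mpow N t) f.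
Proof.
move=> upN IN; split.
  apply: ideal_gen_min; first exact/supp_in_ideal/mpow_upset.
  move=> _ [g [Ig ->]]; elim: t g Ig => [|t IHt] g Ig.
    by rewrite big_ord0.
  rewrite big_ord_recl; apply: (supp_inMM _ ((IN _).1 (Ig ord0))); last first.
    by apply: (IHt (fun i => g (lift ord0 i))).
  by move=> u v Nu Nv; exists u, v.
apply: supp_in_min; first exact: ideal_gen_ideal.
move=> u Nu; have [g [c [Ig ->]]] : exists g : 'I_t -> S, exists c : S,
    (forall i, I (g i)) /\ 'X_[u] = c * \prod_(i < t) g i.
  elim: t u Nu => [|t IHt] u.
    move=> _; exists (fun=> 0), 'X_[u]; split=> [[]//|].
    by rewrite big_ord0 mulr1.
  case=> v [w [Nv /IHt [g [c [Ig ew]]] ->]].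
  exists (fun i => oapp g 'X_[v] (unlift ord0 i)), c; split=> [i|].
    by case: (unlift ord0 i) => //=; apply/IN/supp_inX.
  rewrite big_ord_recl unlift_none /= mulrCA mpolyXD ew; congr (_ * (_ * _)).
  by apply: eq_bigr => i _; rewrite liftK.
by apply: mem_ideal_gen; exists g.
Qed.

(** Pure powers of distinct variables do not interact: each factor taken
    from such an ideal uses up a whole pure power of one variable, and
    [mpow_quot] shows that all the pure powers dividing the monomial can be
    used at once. *)
Lemma is_ord_pure_powers (Q : pred 'I_n) (q : 'I_n -> nat) J u t :
  (forall i, Q i -> 0 < q i)%N ->
  (forall f, J f <-> ideal_gen (fun g => exists2 i, Q i & g = 'X_i ^+ q i) f) ->
  is_ord J 'X_[u] t -> t = (\sum_(i | Q i) u i %/ q i)%N.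
Proof.
move=> q_gt0 JE; pose N v := exists2 i, Q i & (q i <= v i)%N.
have upN : upset N.
  by move=> v w /mnm_lepP le [i Qi /leq_trans ltv]; exists i; rewrite ?ltv.
have JN f : J f <-> supp_in N f.
  rewrite JE; split.
    apply: ideal_gen_min; first exact: supp_in_ideal.
    move=> _ [i Qi ->]; rewrite mpolyXn; apply/supp_inX; exists i => //.
    by rewrite mulmnE mnm1E eqxx mul1n.
  apply: supp_in_min; first exact: ideal_gen_ideal.
  move=> v [i Qi le]; have lev : (U_(i) *+ q i <= v)%MM.
    apply/mnm_lepP=> j; rewrite mulmnE mnm1E.
    by case: eqP => [<-|_]; rewrite ?mul1n ?mul0n.
  rewrite -(submK lev) mpolyXD; apply: mem_ideal_gen; exists i => //.
  by rewrite mpolyXn.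
have Nle s v : mpow N s v -> (s <= \sum_(i | Q i) v i %/ q i)%N.
  elim: s v => // s IHs v [v1 [v2 [[i Qi le1] /IHs le2 ->]]].
  rewrite (bigD1 i) //= mnmDE; rewrite (bigD1 i) //= in le2.
  have le3 : (1 + v2 i %/ q i <= (v1 i + v2 i) %/ q i)%N.
    by rewrite -(divnMDl 1) ?q_gt0 // mul1n leq_div2r // leq_add2r.
  have le4 : (\sum_(j | Q j && (j != i)) v2 j %/ q j
              <= \sum_(j | Q j && (j != i)) (v1 + v2)%MM j %/ q j)%N.
    by apply: leq_sum => j _; rewrite mnmDE leq_div2r // leq_addl.
  by apply: leq_trans (leq_add le3 le4); rewrite -addnA add1n ltnS.
case=> /(ideal_pow_supp t _ upN JN) /supp_inX /Nle le_t nlt.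
apply/eqP; rewrite eqn_leq le_t leqNgt; apply/negP => lt_t; apply: nlt.
apply/(ideal_pow_supp t.+1 _ upN JN)/supp_inX; apply: mpow_leq lt_t _ => //.
apply: mpow_quot => // i Qi; exists i => //.
by rewrite mulmnE mnm1E eqxx mul1n.
Qed.

Definition mixed (i : 'I_n) u : Prop := exists2 a, a != i & u a != 0%N.

Lemma mixed_upset i : upset (mixed i).
Proof.
move=> u v /mnm_lepP uv [a ai ua]; exists a => //.
by rewrite -lt0n (leq_trans _ (uv a)) // lt0n.
Qed.

Lemma not_mixed i u : ~ mixed i u -> u = (U_(i) *+ u i)%MM.
Proof.
move=> nh; apply/mnmP=> j; rewrite mulmnE mnm1E.
case: eqP => [->|/eqP ne]; first by rewrite mul1n.
rewrite mul0n; apply/eqP/negP => /negP uj; apply: nh.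
by exists j; rewrite // eq_sym.
Qed.

Lemma min_pure_le I i q t : min_mono_gen I (U_(i) *+ q)%MM ->
  I 'X_[U_(i) *+ t] -> (q <= t)%N.
Proof.
move=> [_ min] It; rewrite leqNgt; apply/negP => lt_t.
have /mnmP/(_ i) : (U_(i) *+ t)%MM = (U_(i) *+ q)%MM.
  apply: min => //; apply/mnm_lepP=> j; rewrite !mulmnE leq_mul2l.
  by rewrite (ltnW lt_t) orbT.
by rewrite !mulmnE mnm1E eqxx !mul1n => e; rewrite e ltnn in lt_t.
Qed.

(** If [d < q], the forms of degree at most [d] in the ideal contain no
    power of the variable [i], so they lie in the ideal of the mixed
    monomials. An integral equation over it would place a power of the
    variable [i] in that ideal. *)
Lemma pure_exponent_le I N d i q : (forall g, I g <-> supp_in N g) ->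
  min_mono_gen I (U_(i) *+ q)%MM ->
  integral_over_ideal (ideal_le I d) 'X_[U_(i) *+ q] -> (q <= d)%N.
Proof.
move=> IN minq [t [a [t_gt0 ha e]]]; rewrite leqNgt; apply/negP => lt_d.
have upE := @mixed_upset i.
have leE g : ideal_le I d g -> supp_in (mixed i) g.
  apply: ideal_gen_min; first exact: supp_in_ideal.
  move=> f [If [s le_s /dhomogP hf]] u uf; apply: NNPP => /not_mixed eu.
  have : (q <= u i)%N.
    by apply: (min_pure_le minq); rewrite -eu; apply/IN/supp_inX/(IN f).1.
  have : mdeg u = s by apply: hf.
  by rewrite eu mdegMn mdeg1 mulmnE mnm1E eqxx; lia.
have aE j : (j < t)%N -> supp_in (mixed i) (a j).
  move=> /ha; apply: ideal_gen_min; first exact: supp_in_ideal.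
  move=> _ [g [Jg ->]]; rewrite big_ord_recl mulrC.
  by apply: supp_inM => //; apply: leE.
have : supp_in (mixed i) ('X_[(U_(i) *+ q)] ^+ t : S).
  move/eqP: e; rewrite addr_eq0 => /eqP ->; apply: supp_inN.
  apply: supp_in_sum => j _ _; rewrite mulrC; apply: supp_inM => //.
  exact: aE.
rewrite mpolyXn => /supp_inX [b bi].
by rewrite !mulmnE mnm1E [i == b]eq_sym (negPf bi).
Qed.

End Ideals.

(** * Monomials of top degree *)

Section TopDegree.
Variables (k : fieldType) (n : nat).
Local Notation S := {mpoly k[n]}.
Implicit Types (U N : 'X_{1..n} -> Prop) (u v w : 'X_{1..n}).

Lemma max_degree_outside U B u : (forall v, (B <= mdeg v)%N -> U v) -> ~ U u ->
  exists v, [/\ ~ U v, (mdeg u <= mdeg v)%N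
              & forall w, (mdeg v < mdeg w)%N -> U w].
Proof.
move=> cofU; have [h] := ubnP (B - mdeg u); elim: h u => // h IHh u.
rewrite ltnS => le_h nUu.
have [[v [lt_uv nUv]]|none] := classic (exists v, (mdeg u < mdeg v)%N /\ ~ U v).
  have ltB : (mdeg u < B)%N.
    by rewrite ltnNge; apply/negP => /cofU.
  have [|w [nUw le_vw top]] := IHh v _ nUv; first by lia.
  by exists w; split=> //; apply: leq_trans le_vw; apply: ltnW.
exists u; split=> // w lt_uw; apply: NNPP => nUw.
by apply: none; exists w.
Qed.

Lemma mpow_cofinite N (p : 'I_n -> nat) m u : upset N ->
  (forall i, N (U_(i) *+ p i)%MM) -> (forall i, 0 < p i)%N ->
  ((\sum_i m * p i).+1 <= mdeg u)%N -> mpow N m u.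
Proof.
move=> upN Np p_gt0; rewrite mdegE => lt_u.
have [i lt_i] : exists i, (m * p i < u i)%N.
  apply: NNPP => none; move: lt_u; rewrite ltnNge; case/negP.
  apply: leq_sum => i _; rewrite leqNgt; apply/negP => ?.
  by apply: none; exists i.
have Nq := @mpow_quot _ N p predT u upN (fun i _ => Np i).
apply: (mpow_leq upN _ Nq).
rewrite (bigD1 i) //=; apply: leq_trans (leq_addr _ _).
by rewrite leq_divRL // ltnW.
Qed.

(** The factors of a pure power are pure powers. *)
Lemma mpow_pure N (x : 'I_n) d t j :
  (forall i, N (U_(x) *+ i)%MM -> d <= i)%N ->
  mpow N t (U_(x) *+ j)%MM -> (d * t <= j)%N.
Proof.
move=> Nd; elim: t j => [|t IHt] j; first by rewrite muln0.
case=> v [w [Nv Nw e]].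
have pure z : (z <= U_(x) *+ j)%MM -> z = (U_(x) *+ z x)%MM.
  move=> /mnm_lepP le; apply: not_mixed => -[a ax].
  by have := le a; rewrite mulmnE mnm1E eq_sym (negPf ax) leqn0 => ->.
have ev := pure v; have ew := pure w.
rewrite ev in Nv; last by rewrite e lem_addr.
rewrite ew in Nw; last by rewrite e lem_addl.
have := congr1 (fun z : 'X_{1..n} => z x) e.
rewrite mnmDE mulmnE mnm1E eqxx mul1n => ->.
by rewrite mulnS leq_add // ?Nd // IHt.
Qed.

(** If some monomial outside [K] had larger degree, one of maximal degree would
    be a socle element of larger degree. *)
Lemma in_w_topdeg U (K : S -> Prop) B u :
  (forall f, K f <-> supp_in U f) -> (forall v, (B <= mdeg v)%N -> U v) ->
  in_w K 'X_[u] -> ~ U u /\ (forall v, (mdeg u < mdeg v)%N -> U v).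
Proof.
move=> KU cofU [_ [[nKu _] [t [nKt _] max_t]]].
have et : t = mdeg u.
  apply/eqP; rewrite eq_sym; apply/negPn/negP => ne; apply: nKt.
  have -> : pihomog mdeg t ('X_[u] : S) = 0 by rewrite pihomogX (negPf ne).
  by apply/KU; apply: supp_in0.
split=> [Uu|v lt_v]; first by apply/nKu/KU/supp_inX.
apply: NNPP => nUv; have [w [nUw le_vw top]] := max_degree_outside cofU nUv.
suff : (mdeg w <= t)%N by rewrite et leqNgt (leq_trans lt_v).
apply: (max_t 'X_[w]).
  split=> [/KU /supp_inX //|g /max_ideal_hits hg]; apply/KU; rewrite mulrC.
  apply: (supp_inMM (U := fun z => z = w) _ _ hg); last exact/supp_inX.
  move=> _ z -> [a _ za]; apply: top.
  rewrite mdegD -{1}[mdeg w]addn0 ltn_add2l lt0n.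
  by rewrite mdeg_eq0; apply/eqP => z0; rewrite z0 mnm0E in za.
split=> [|s lt_s]; first by rewrite pihomogX eqxx => /KU /supp_inX.
have -> : pihomog mdeg s ('X_[w] : S) = 0 by rewrite pihomogX ltn_eqF.
by apply/KU; apply: supp_in0.
Qed.

End TopDegree.

Theorem theorem3p2 (k : fieldType) (n : nat) (I : {mpoly k[n]} -> Prop)
    (d l : nat) (p : 'I_n -> nat) (x : 'I_n) (e : nat -> int)
    (hchar : [pchar k] =i pred0)
    (hprim : is_m_primary I)
    (hmon : is_monomial_ideal I)
    (hd : asymptotic_generating_degree I d)
    (hp : forall i : 'I_n, min_mono_gen I (U_(i) *+ p i)%MM)
    (hx : p x = d)
    (hl : l = #|[set i : 'I_n | p i == d]|)
    (he : forall m : nat, (0 < m)%N ->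
            is_regularity (ideal_pow I m) ((d * m)%N%:Z + e m))
    (m : nat) (hm : (0 < m)%N)
    (mu : int) (hmu : is_min_mbar d p x (ideal_pow I m) m mu)
    (hbound : (n%:Z - 1) * (d%:Z - 2) + (mu - 1) * (l%:Z - 1) * (d%:Z - 1)
              < m%:Z) :
  e m <= e m.+1.
Proof.
pose N u := I 'X_[u]; have [[[I0 ID IM] nI1 _] _] := hprim.
have idI : is_ideal I by [].
have upN : upset N.
  by move=> u v /submK <-; rewrite /N mpolyXD; apply: IM.
have IN f : I f <-> supp_in N f.
  split; last by apply: supp_in_min.
  have [M IME] := hmon; move/IME/ideal_gen_monomials => Mf u /Mf Mu.
  by apply/IME/ideal_gen_monomials/supp_inX.
have Np i : N (U_(i) *+ p i)%MM by case: (hp i).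
have p_gt0 i : (0 < p i)%N.
  rewrite lt0n; apply/eqP => pi0; apply: nI1.
  by have := Np i; rewrite pi0 /N mulm0n mpolyX0.
have p_le i : (p i <= d)%N.
  by apply: (pure_exponent_le IN (hp i)); apply: (hd.1); apply: Np.
have n_gt0 : (0 < n)%N by apply: leq_ltn_trans (ltn_ord x).
have KN t f : ideal_pow I t f <-> supp_in (mpow N t) f by apply: ideal_pow_supp.
have cofK t v : ((\sum_i t * p i).+1 <= mdeg v)%N -> mpow N t v.
  exact: mpow_cofinite.
have reg_top t v : (0 < t)%N -> ~ mpow N t v ->
    (forall w, (mdeg v < mdeg w)%N -> mpow N t w) ->
    (d * t)%N%:Z + e t = (mdeg v).+1%:Z.
  move=> t_gt0 nKv top.
  apply: (regularity_topdeg (f := 'X_[v]) n_gt0 _ _ _ (he t t_gt0)).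
  - by move=> g degg; apply/KN => w /degg /top.
  - exact/supp_inX.
  - by move/KN/supp_inX.
have [[u /(in_w_topdeg (KN m) (cofK m)) [nKu topu] mbar_u] _] := hmu.
have lt_quot : (\sum_i u i %/ p i < m)%N.
  rewrite ltnNge; apply/negP => le; apply: nKu; apply: (mpow_leq upN le).
  exact: mpow_quot.
pose b := (m - \sum_i u i %/ p i)%N.
have em : m = (b + \sum_i u i %/ p i)%N by rewrite subnK // ltnW.
have d_gt0 : (0 < d)%N by rewrite -hx.
(* The sums over x, Y and Z in mbar split the sum over all variables. *)
have mu_b : mu = b%:Z.
  have [tY [tZ [ordY ordZ ->]]] := mbar_u.
  have -> : tY = (\sum_(i | (i != x) && (p i == d)) u i %/ d)%N.
    exact: (is_ord_pure_powers (q := fun=> d) _ _ ordY).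
  have -> : tZ = (\sum_(i | p i < d) u i %/ p i)%N.
    exact: (is_ord_pure_powers _ _ ordZ).
  suff es : (\sum_i u i %/ p i = u x %/ d
      + \sum_(i | (i != x) && (p i == d)) u i %/ d
      + \sum_(i | p i < d) u i %/ p i)%N by move: em; rewrite es; lia.
  rewrite (bigD1 x) //= hx -addnA; congr (_ + _)%N.
  rewrite (bigID (fun i => p i == d)) /=; congr (_ + _)%N.
    by apply: eq_bigr => i /andP[_ /eqP->].
  apply: eq_bigl => i; rewrite ltn_neqAle p_le andbT.
  by case: (i =P x) => [->|] //=; rewrite hx eqxx.
rewrite leNgt; apply/negP => lt_e.
have e_m := reg_top m u hm nKu topu.
(* If some such monomial were missing, the top degree would rise by at least d
   from one power to the next, contrary to [lt_e]. *)
have topS w : (mdeg u + d <= mdeg w)%N -> mpow N m.+1 w.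
  move=> le_w; apply: NNPP => nKw.
  have [v [nKv le_wv topv]] := max_degree_outside (cofK m.+1) nKw.
  have := reg_top m.+1 v isT nKv topv; rewrite mulnS.
  by move: e_m lt_e le_w le_wv; lia.
(* The power of exponent d * m - 1 of x is outside the m-th power. *)
have ge_deg : (d * m <= (mdeg u).+1)%N.
  rewrite leqNgt; apply/negP => lt_deg.
  have pureN j : N (U_(x) *+ j)%MM -> (d <= j)%N.
    by rewrite -hx; apply: min_pure_le (hp x).
  have /(mpow_pure pureN) : mpow N m (U_(x) *+ (d * m).-1)%MM.
    by apply: topu; rewrite mdegMn mdeg1 mul1n; lia.
  by rewrite leqNgt ltn_predL (leq_trans _ lt_deg).
have exp_lt i : p i = d -> (u i %/ d + u i %% d < b * d.-1)%N.
  by move=> pi; apply: exponent_bound upN Np p_gt0 p_le pi em nKu topS.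
have := defect_bound p_gt0 p_le em exp_lt ge_deg.
by rewrite -hl -mu_b leNgt hbound.
Qed.
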